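(* For all $n,N\in\mathbb{N}\cup\{0\}$, \[ A_{n+N}(t)=\sum_{i=1}^{N+1}a_{i-1}(N,t)\,(1-t)^{N+1-i}\,A_n^{(i)}(t), \] as an identity of polynomials in $t$ (equivalently, for all $t$).
   Context: The Eulerian polynomials $A_n(t)$ are defined by $\dfrac{1-t}{e^{x(t-1)}-t}=\sum_{n\ge 0}A_n(t)\dfrac{x^n}{n!}$. For a positive integer $m$, the higher-order Eulerian polynomials $A_n^{(m)}(t)$ are defined by $\left(\dfrac{1-t}{e^{x(t-1)}-t}\right)^{m}=\sum_{n\ge 0}A_n^{(m)}(t)\dfrac{x^n}{n!}$ (these are polynomials in $t$). The coefficients $a_i(N,t)$, for integers $N\ge 0$ and $0\le i\le N$, are defined by $a_0(N,t)=1$ for all $N\ge0$ and $a_i(N,t)=i\,t\sum_{j=0}^{N-i}(i+1)^{j}a_{i-1}(N-j-1,t)$ for $1\le i\le N$. *)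

(* Defs.v *)
From HB Require Import structures.
From mathcomp Require Import all_boot all_order all_algebra.
From mathcomp Require Import fraction.
From mathcomp Require Import boolp.

Set Implicit Arguments.
Unset Strict Implicit.
Unset Printing Implicit Defensive.
Import GRing.Theory.
Local Open Scope ring_scope.

(* Formal power series in one variable x; [fps_coef f n] is the coefficient
   of x^n.  The record keeps the Cauchy product apart from the pointwise
   product that a bare function type could carry. *)
Record fps (R : Type) := Fps { fps_coef : nat -> R }.

Lemma fpsP (R : Type) (f g : fps R) :
  fps_coef f =1 fps_coef g -> f = g.
Proof. by case: f g => [f] [g] /= /funext ->. Qed.

HB.instance Definition _ (R : Type) := gen_eqMixin (fps R).
HB.instance Definition _ (R : Type) := gen_choiceMixin (fps R).

Section FpsRing.
Variable R : comNzRingType.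
Implicit Types f g h : fps R.

Definition fpsC (c : R) : fps R := Fps (fun n => if n == 0%N then c else 0).
Definition fps_add f g : fps R := Fps (fun n => fps_coef f n + fps_coef g n).
Definition fps_opp f : fps R := Fps (fun n => - fps_coef f n).
Definition fps_mul f g : fps R :=
  Fps (fun n => \sum_(i < n.+1) fps_coef f i * fps_coef g (n - i)%N).

Fact fps_addA : associative fps_add.
Proof. by move=> f g h; apply: fpsP => n /=; rewrite addrA. Qed.
Fact fps_addC : commutative fps_add.
Proof. by move=> f g; apply: fpsP => n /=; rewrite addrC. Qed.
Fact fps_add0 : left_id (fpsC 0) fps_add.
Proof. by move=> f; apply: fpsP => n /=; rewrite if_same add0r. Qed.
Fact fps_addN : left_inverse (fpsC 0) fps_opp fps_add.
Proof. by move=> f; apply: fpsP => n /=; rewrite if_same addNr. Qed.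

HB.instance Definition _ :=
  GRing.isZmodule.Build (fps R) fps_addA fps_addC fps_add0 fps_addN.

Let trunc n f : {poly R} := \poly_(i < n.+1) fps_coef f i.

Let coef_trunc n f k : (k <= n)%N -> (trunc n f)`_k = fps_coef f k.
Proof. by move=> le_kn; rewrite coef_poly ltnS le_kn. Qed.

Let coef_mul_trunc n f g k :
  (k <= n)%N -> fps_coef (fps_mul f g) k = (trunc n f * trunc n g)`_k.
Proof.
move=> le_kn; rewrite coefM /=; apply: eq_bigr => i _.
rewrite !coef_trunc //; first exact: leq_trans (leq_subr _ _) le_kn.
by apply: leq_trans le_kn; rewrite -ltnS.
Qed.

Fact fps_mulC : commutative fps_mul.
Proof.
by move=> f g; apply: fpsP => n; rewrite !(@coef_mul_trunc n) // mulrC.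
Qed.
Fact fps_mulA : associative fps_mul.
Proof.
move=> f g h; apply: fpsP => n.
transitivity (trunc n f * (trunc n g * trunc n h))`_n.
  rewrite coefM; apply: eq_bigr => i _.
  by rewrite (@coef_mul_trunc n) ?leq_subr // coef_trunc // -ltnS.
rewrite mulrA coefM; apply: eq_bigr => i _.
by rewrite (@coef_mul_trunc n) ?coef_trunc ?leq_subr // -ltnS.
Qed.
Fact fps_mul1 : left_id (fpsC 1) fps_mul.
Proof.
move=> f; apply: fpsP => n /=.
rewrite big_ord_recl /= mul1r subn0 big1 ?addr0 // => i _.
by rewrite mul0r.
Qed.
Fact fps_mulDl : left_distributive fps_mul fps_add.
Proof.
move=> f g h; apply: fpsP => n /=; rewrite -big_split /=.
by apply: eq_bigr => i _; rewrite mulrDl.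
Qed.
Fact fps_1neq0 : fpsC 1 != 0.
Proof.
apply/eqP => /(congr1 (fun f => fps_coef f 0)) /= /eqP.
by rewrite oner_eq0.
Qed.

HB.instance Definition _ := GRing.Zmodule_isComNzRing.Build (fps R)
  fps_mulA fps_mulC fps_mul1 fps_mulDl fps_1neq0.

Lemma fps_coef0 n : fps_coef (0 : fps R) n = 0.
Proof. by rewrite /= if_same. Qed.
Lemma fps_coef1 n : fps_coef (1 : fps R) n = (n == 0%N)%:R.
Proof. by rewrite /=; case: eqP. Qed.
Lemma fps_coefD f g n : fps_coef (f + g) n = fps_coef f n + fps_coef g n.
Proof. by []. Qed.
Lemma fps_coefN f n : fps_coef (- f) n = - fps_coef f n.
Proof. by []. Qed.
Lemma fps_coefM f g n :
  fps_coef (f * g) n = \sum_(i < n.+1) fps_coef f i * fps_coef g (n - i)%N.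
Proof. by []. Qed.

End FpsRing.

Section FpsUnitRing.
Variable R : comUnitRingType.
Implicit Types f g : fps R.

(* The first n coefficients of 1 / f, when f has an invertible constant
   coefficient. *)
Fixpoint fps_inv_seq f n : seq R :=
  if n is k.+1 then
    let s := fps_inv_seq f k in
    rcons s ((fps_coef f 0)^-1 *
             ((k == 0%N)%:R - \sum_(i < k) s`_i * fps_coef f (k - i)%N))
  else [::].

Definition fps_unit : {pred fps R} :=
  [pred f | fps_coef f 0 \is a GRing.unit].
Definition fps_inv f : fps R :=
  if f \in fps_unit then Fps (fun n => (fps_inv_seq f n.+1)`_n) else f.

Let size_inv_seq f n : size (fps_inv_seq f n) = n.
Proof. by elim: n => //= n IHn; rewrite size_rcons IHn. Qed.

Let nth_inv_seq f n i :
  (i < n)%N -> (fps_inv_seq f n)`_i = (fps_inv_seq f i.+1)`_i.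
Proof.
elim: n => // n IHn; rewrite ltnS leq_eqVlt => /orP[/eqP -> //|lt_in].
by rewrite -IHn // [LHS]nth_rcons size_inv_seq lt_in.
Qed.

Fact fps_mulVx : {in fps_unit, left_inverse 1 fps_inv *%R}.
Proof.
move=> f fU; apply: fpsP => n; rewrite fps_coef1 fps_coefM /fps_inv fU.
transitivity (\sum_(i < n) (fps_inv_seq f n)`_i * fps_coef f (n - i)%N
              + (fps_inv_seq f n.+1)`_n * fps_coef f 0).
  rewrite big_ord_recr; congr (_ + _); last by rewrite -[LHS]/(_ * _) subnn.
  by apply: eq_bigr => i _; rewrite nth_inv_seq.
rewrite /= nth_rcons size_inv_seq ltnn eqxx mulrAC mulVr // mul1r.
by rewrite addrC subrK.
Qed.
Fact fps_unitPl f g : g * f = 1 -> fps_unit f.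
Proof.
move/(congr1 (fun h => fps_coef h 0)); rewrite fps_coefM big_ord1 /= => gf1.
by apply/unitrPr; exists (fps_coef g 0); rewrite mulrC.
Qed.
Fact fps_inv_out : {in [predC fps_unit], fps_inv =1 id}.
Proof. by move=> f; rewrite inE /= /fps_inv => /negPf ->. Qed.

HB.instance Definition _ := GRing.ComNzRing_hasMulInverse.Build (fps R)
  fps_mulVx fps_unitPl fps_inv_out.

Lemma fps_unitE f : (f \is a GRing.unit) = (fps_coef f 0 \is a GRing.unit).
Proof. by []. Qed.

(* e^(c x) *)
Definition fps_exp (c : R) : fps R := Fps (fun n => c ^+ n / n`!%:R).

End FpsUnitRing.

Section FpsMap.
Variables (R S : comNzRingType) (phi : {rmorphism R -> S}).

Definition fps_map (f : fps R) : fps S := Fps (fun n => phi (fps_coef f n)).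

Lemma fps_map1 : fps_map 1 = 1.
Proof. by apply: fpsP => n; rewrite [RHS]fps_coef1 -(rmorph_nat phi) -fps_coef1. Qed.

Lemma fps_mapM f g : fps_map (f * g) = fps_map f * fps_map g.
Proof.
apply: fpsP => n /=; rewrite rmorph_sum.
by apply: eq_bigr => i _; rewrite rmorphM.
Qed.

Lemma fps_mapX f m : fps_map (f ^+ m) = fps_map f ^+ m.
Proof.
by elim: m => [|m IHm]; rewrite ?expr0 ?fps_map1 // !exprS fps_mapM IHm.
Qed.

End FpsMap.

(* The field Q(t); t is the indeterminate 'X of {poly rat}. *)
Notation ratfun := {fraction {poly rat}}.
Definition tvar : ratfun := tofrac 'X.

(* (1 - t) / (e^(x(t-1)) - t), as a power series in x over Q(t): the constant
   coefficient 1 - t of the denominator is not invertible in Q[t]. *)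
Definition eulerian_gf : fps ratfun :=
  fpsC (1 - tvar) / (fps_exp (tvar - 1) - fpsC tvar).

(* (e^(x(t-1)) - t) / (1 - t): it has coefficients in Q[t] and constant
   coefficient 1, so its inverse has coefficients in Q[t] too. *)
Definition eulerian_den : fps {poly rat} :=
  Fps (fun n => if n is k.+1 then - (('X - 1) ^+ k * ((n`!%:R)^-1)%:P) else 1).

Lemma tvar_neq1 : 1 - tvar != 0.
Proof.
rewrite subr_eq0 -tofrac1 tofrac_eq eq_sym; apply/eqP => /(congr1 (coefp 1)).
by rewrite /= coefX coef1.
Qed.

Lemma eulerian_gf_den_unit :
  fps_exp (tvar - 1) - fpsC tvar \is a GRing.unit.
Proof. by rewrite fps_unitE /= expr0 divr1 unitfE tvar_neq1. Qed.

Lemma eulerian_gf_map : eulerian_gf = fps_map (@tofrac {poly rat}) eulerian_den^-1.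
Proof.
have denU : eulerian_den \is a GRing.unit by rewrite fps_unitE /= unitr1.
have denE : fps_exp (tvar - 1) - fpsC tvar =
    fpsC (1 - tvar) * fps_map (@tofrac {poly rat}) eulerian_den.
  apply: fpsP => n; rewrite fps_coefM big_ord_recl big1 => [|i _]; last first.
    by rewrite /= mul0r.
  rewrite addr0 subn0 /=; case: n => [|n] /=.
    by rewrite expr0 divr1 rmorph1 mulr1.
  rewrite oppr0 addr0 !rmorphN rmorphM rmorphXn rmorphB rmorph1 /=.
  rewrite mulrN -mulNr opprB mulrA -exprS; congr (_ * _).
  have nz : (n.+1`!%:R : rat) != 0 by rewrite Num.Theory.pnatr_eq0 -lt0n fact_gt0.
  apply: (@mulfI _ n.+1`!%:R).
    rewrite -tofrac1 -tofracMn tofrac_eq0 -polyC1 -polyCMn polyC_eq0.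
    exact: nz.
  rewrite mulfV; last first.
    rewrite -tofrac1 -tofracMn tofrac_eq0 -polyC1 -polyCMn polyC_eq0.
    exact: nz.
  by rewrite -(rmorph_nat (@tofrac {poly rat})) -rmorphM -polyC_natr
             -polyCM mulfV // rmorph1.
rewrite /eulerian_gf; apply: (mulIr eulerian_gf_den_unit).
rewrite divrK ?eulerian_gf_den_unit // denE mulrCA -fps_mapM mulVr //.
by rewrite fps_map1 mulr1.
Qed.

Lemma higher_eulerian_ex (m n : nat) :
  exists p : {poly rat},
    tofrac p == n`!%:R * fps_coef (eulerian_gf ^+ m) n.
Proof.
exists (n`!%:R * fps_coef (eulerian_den^-1 ^+ m) n).
by rewrite eulerian_gf_map -fps_mapX rmorphM rmorph_nat.
Qed.

Lemma eulerian_ex (n : nat) :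
  exists p : {poly rat}, tofrac p == n`!%:R * fps_coef eulerian_gf n.
Proof. exact: higher_eulerian_ex 1 n. Qed.

(* A_n and A_n^(m): the (unique, as tofrac is injective) polynomials equal in
   Q(t) to n! times the coefficient of x^n in the generating series. *)
Definition eulerian (n : nat) : {poly rat} := xchoose (eulerian_ex n).
Definition higher_eulerian (m n : nat) : {poly rat} :=
  xchoose (higher_eulerian_ex m n).

Lemma eulerianE n :
  tofrac (eulerian n) = n`!%:R * fps_coef eulerian_gf n.
Proof. exact/eqP/(xchooseP (eulerian_ex n)). Qed.

Lemma higher_eulerianE m n :
  tofrac (higher_eulerian m n) = n`!%:R * fps_coef (eulerian_gf ^+ m) n.
Proof. exact/eqP/(xchooseP (higher_eulerian_ex m n)). Qed.

(* a_i(N, t), meaningful only for i <= N: the recursive calls stay in that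
   range, and for i > N the truncated subtractions give junk values. *)
Fixpoint eul_coef (i N : nat) : {poly rat} :=
  if i is k.+1 then
    i%:R * 'X * \sum_(0 <= j < (N - i).+1) i.+1%:R ^+ j * eul_coef k (N - j - 1)%N
  else 1.

(* Main.v *)
(* The generating function F = (1 - t) / (e^(x(t-1)) - t) satisfies the Riccati
   equation F' = (1 - t) F + t F^2, so (F^m)' = m (1 - t) F^m + m t F^(m+1).
   Comparing coefficients expresses A^(m)_(n+1) through A^(m)_n and A^(m+1)_n,
   and induction on N then only needs the triangular recurrence
   a_i(N+1) = (i+1) a_i(N) + i t a_(i-1)(N). *)
Require Import Defs.
From mathcomp Require Import all_boot all_order all_algebra.
From mathcomp Require Import fraction ring.
Set Implicit Arguments.
Unset Strict Implicit.
Unset Printing Implicit Defensive.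
Import GRing.Theory.
Local Open Scope ring_scope.

Section FpsDeriv.
Variable R : comNzRingType.
Implicit Types f g : fps R.

Definition fps_deriv f : fps R := Fps (fun n => fps_coef f n.+1 *+ n.+1).

Lemma fps_coef_mulC (c : R) f n : fps_coef (fpsC c * f) n = c * fps_coef f n.
Proof.
rewrite fps_coefM big_ord_recl big1 ?addr0 ?subn0 // => i _.
by rewrite /= mul0r.
Qed.

Lemma fpsCN (c : R) : fpsC (- c) = - fpsC c.
Proof. by apply: fpsP => n /=; case: eqP; rewrite ?oppr0. Qed.

Lemma fps_coefMn f k n : fps_coef (f *+ k) n = fps_coef f n *+ k.
Proof.
elim: k => [|k IHk]; first exact: fps_coef0.
by rewrite !mulrS fps_coefD IHk.
Qed.

Lemma fps_derivC (c : R) : fps_deriv (fpsC c) = 0.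
Proof. by apply: fpsP => n; rewrite fps_coef0 /= mul0rn. Qed.

Lemma fps_derivB f g : fps_deriv (f - g) = fps_deriv f - fps_deriv g.
Proof.
by apply: fpsP => n; rewrite fps_coefD fps_coefN /= mulrnBl.
Qed.

Lemma fps_derivM f g :
  fps_deriv (f * g) = fps_deriv f * g + f * fps_deriv g.
Proof.
apply: fpsP => n; rewrite [RHS]fps_coefD !fps_coefM.
rewrite -[LHS]/(fps_coef (f * g) n.+1 *+ n.+1) fps_coefM -sumrMnl.
transitivity (\sum_(i < n.+2) (fps_coef f i *+ i * fps_coef g (n.+1 - i)%N
   + fps_coef f i * (fps_coef g (n.+1 - i)%N *+ (n.+1 - i)))).
  apply: eq_bigr => i _; rewrite mulrnAl mulrnAr -mulrnDr subnKC //.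
  by rewrite -ltnS.
rewrite big_split /=; congr (_ + _).
  rewrite big_ord_recl mulr0n mul0r add0r.
  by apply: eq_bigr => i _; rewrite subSS.
rewrite big_ord_recr /= subnn mulr0n mulr0 addr0.
by apply: eq_bigr => i _; rewrite subSn // -ltnS.
Qed.

Lemma fps_derivX f m :
  fps_deriv (f ^+ m.+1) = (f ^+ m * fps_deriv f) *+ m.+1.
Proof.
elim: m => [|m IHm]; first by rewrite expr1 expr0 mul1r.
by rewrite exprS fps_derivM IHm mulrnAr mulrA -exprS mulrC [RHS]mulrS.
Qed.

(** The coefficient of x^n in [(f ^+ m.+1)' = m.+1 f ^+ m f'], once the Riccati equation replaces
    f'. *)
Lemma fps_coefXS_riccati (a b : R) f m n :
  fps_deriv f = fpsC a * f + fpsC b * f ^+ 2 ->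
  n.+1%:R * fps_coef (f ^+ m.+1) n.+1 =
  m.+1%:R * (a * fps_coef (f ^+ m.+1) n + b * fps_coef (f ^+ m.+2) n).
Proof.
move=> df; rewrite mulr_natl -[LHS]/(fps_coef (fps_deriv _) n) fps_derivX df.
rewrite mulrDr ![f ^+ m * (_ * _)]mulrCA -exprSr -exprS.
by rewrite fps_coefMn fps_coefD !fps_coef_mulC mulr_natl.
Qed.

End FpsDeriv.

(** The hypothesis is characteristic zero: the factor n+1 brought down by the derivative then
    cancels against that of (n+1)!. *)
Lemma fps_deriv_exp (F : fieldType) (c : F) :
  (forall n, n.+1%:R != 0 :> F) ->
  fps_deriv (fps_exp c) = fpsC c * fps_exp c.
Proof.
move=> nz; apply: fpsP => n; rewrite fps_coef_mulC /= exprS -mulrA -mulrnAr.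
congr (_ * _); rewrite -mulrnAr; congr (_ * _).
by rewrite factS natrM invfM -mulrnAl -[_ *+ n.+1]mulr_natl mulfV ?mul1r.
Qed.

Lemma ratfun_natS_neq0 n : n.+1%:R != 0 :> ratfun.
Proof.
rewrite -(rmorph_nat (@tofrac {poly rat})) tofrac_eq0 -polyC_natr polyC_eq0.
by rewrite Num.Theory.pnatr_eq0.
Qed.

Lemma eulerian_gf_riccati :
  fps_deriv eulerian_gf =
  fpsC (1 - tvar) * eulerian_gf + fpsC tvar * eulerian_gf ^+ 2.
Proof.
set F := eulerian_gf; set E := fps_exp (tvar - 1).
have GU : E - fpsC tvar \is a GRing.unit := eulerian_gf_den_unit.
have FG : F * (E - fpsC tvar) = fpsC (1 - tvar) by rewrite /F divrK.
have dE : fps_deriv E = - fpsC (1 - tvar) * E.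
  by rewrite (fps_deriv_exp _ ratfun_natS_neq0) -fpsCN opprB.
have := congr1 (@fps_deriv _) FG.
rewrite fps_derivC fps_derivM fps_derivB fps_derivC subr0 dE => dFG.
(* With G = E - t, differentiating F G = 1 - t gives F' G = (1 - t) F E. The equation times the unit
   G follows by writing 1 - t as F G and E as G + t. *)
apply: (mulIr GU); apply/eqP; rewrite -subr_eq0 -dFG; apply/eqP.
rewrite -FG; ring.
Qed.

(** As [tofrac] is injective, this can be checked in Q(t), where it is the Riccati relation between
    coefficients multiplied by n!. *)
Lemma higher_eulerianS m n :
  higher_eulerian m.+1 n.+1 =
  m.+1%:R * (1 - 'X) * higher_eulerian m.+1 n
  + m.+1%:R * 'X * higher_eulerian m.+2 n.
Proof.
(* Abstracting the polynomials keeps unification from unfolding [xchoose]. *)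
have := higher_eulerianE m.+1 n.+1; have := higher_eulerianE m.+1 n.
have := higher_eulerianE m.+2 n.
move: (higher_eulerian m.+2 n) (higher_eulerian m.+1 n).
move: (higher_eulerian m.+1 n.+1).
move=> C A B AE BE CE; apply/eqP; rewrite -tofrac_eq; apply/eqP.
rewrite tofracD !tofracM.
rewrite tofracB tofrac1 rmorph_nat AE BE CE -[tofrac 'X]/tvar.
rewrite factS natrM mulrAC (fps_coefXS_riccati _ _ eulerian_gf_riccati).
ring.
Qed.

Lemma higher_eulerian1 n : higher_eulerian 1 n = eulerian n.
Proof.
by apply/eqP; rewrite -tofrac_eq higher_eulerianE eulerianE expr1.
Qed.

(* The test discards the junk value of a_(N+1)(N), which should count as 0. *)
Lemma eul_coefSS i N : (i <= N)%N ->
  eul_coef i.+1 N.+1 =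
  (if (i < N)%N then i.+2%:R * eul_coef i.+1 N else 0)
  + i.+1%:R * 'X * eul_coef i N.
Proof.
(* The term j = 0 is the summand in [eul_coef i N]. The later terms, with one factor i+2 taken out,
   form the sum defining [eul_coef i.+1 N]; there are none when i = N. *)
move=> le_iN; rewrite /= subSS big_nat_recl // expr0 mul1r subn0 subSS subn0.
rewrite mulrDr addrC; congr (_ + _); case: ltnP => [lt_iN|le_Ni]; last first.
  by rewrite (eqP (_ : N - i == 0)%N) ?subn_eq0 // big_geq // mulr0.
rewrite mulrCA subnSK // [in RHS]big_distrr /=; congr (_ * _).
by apply: eq_bigr => j _; rewrite exprS mulrA subSS.
Qed.

Theorem theorem2 (n N : nat) :
  eulerian (n + N)%N =
  \sum_(1 <= i < N.+2)
     eul_coef i.-1 N * (1 - 'X) ^+ (N + 1 - i)%N * higher_eulerian i n.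
Proof.
rewrite big_add1 /=.
under eq_bigr do rewrite addn1 subSS.
elim: N n => [|N IHN] n.
  by rewrite addn0 big_nat1 subn0 expr0 !mul1r higher_eulerian1.
(* One unit moves from N to n, so the induction hypothesis applies at n+1. *)
rewrite -addSnnS IHN.
under eq_bigr do rewrite higher_eulerianS mulrDr.
rewrite big_split /= [RHS]big_nat_recl //.
have -> : \sum_(0 <= i < N.+1) eul_coef i.+1 N.+1 * (1 - 'X) ^+ (N.+1 - i.+1)
    * higher_eulerian i.+2 n =
  \sum_(0 <= i < N.+1) (if (i < N)%N then i.+2%:R * eul_coef i.+1 N else 0)
    * (1 - 'X) ^+ (N - i) * higher_eulerian i.+2 n
  + \sum_(0 <= i < N.+1) i.+1%:R * 'X * eul_coef i N
    * (1 - 'X) ^+ (N - i) * higher_eulerian i.+2 n.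
  rewrite -big_split; apply: eq_big_nat => i; rewrite ltnS => /andP[_ le_iN].
  by rewrite eul_coefSS // subSS !mulrDl.
rewrite addrA; congr (_ + _); last by apply: eq_bigr => i _; ring.
(* The two sums are offset by one: the left one gives up its term i = 0, the right one its vanishing
   term i = N. *)
rewrite big_nat_recl // [in RHS]big_nat_recr //= ltnn !mul0r addr0.
congr (_ + _); first by rewrite !subn0 exprS; ring.
apply: eq_big_nat => i /andP[_ lt_iN]; rewrite lt_iN -(subnSK lt_iN) exprS.
ring.
Qed.
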